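(* Let $A\subseteq\mathbb N$ be a set which is simple and not hyperhypersimple. Then $E_A$ is a dark ceer and $E_A$ is high for the computable FS-jump.
   Context: $\phi_e$ is the $e$-th partial computable function, $W_e$ its domain. A set $A$ is simple if it is c.e., $A^c$ is infinite, and no infinite c.e. set is contained in $A^c$. A c.e. set $A$ is hyperhypersimple if for every computable $f$ such that $\{W_{f(n)}:n\in\mathbb N\}$ is a pairwise disjoint family of finite sets, there is $n$ with $W_{f(n)}\subseteq A$. $E_A$ is the equivalence relation with $m\mathrel{E_A}n$ iff $m=n$ or $m,n\in A$. A ceer is an equivalence relation on $\mathbb N$ that is c.e. as a set of pairs. $E\leq F$ means there is a total computable $f$ with $x\mathrel{E}y\iff f(x)\mathrel{F}f(y)$; bireducible means both ways. $\mathsf{id}$ is the identity on $\mathbb N$. A ceer is dark if it has infinitely many classes and $\mathsf{id}\not\leq E$. $=^{ce}$ is $e=^{ce}e'$ iff $W_e=W_{e'}$. The computable FS-jump is $E^+$ with $e\mathrel{E^+}e'$ iff $\{[\phi_e(n)]_E:\phi_e(n)\downarrow\}=\{[\phi_{e'}(n)]_E:\phi_{e'}(n)\downarrow\}$. A ceer $E$ is high for the computable FS-jump if $E^+$ is computably bireducible with $=^{ce}$. *)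

(* Defs.v *)
From mathcomp Require Import all_boot.
From mathcomp Require Import boolp classical_sets functions cardinality.
From Stdlib Require Import RelationClasses.
From Stdlib Require Cantor.

Set Implicit Arguments.
Unset Strict Implicit.
Unset Printing Implicit Defensive.

Local Open Scope classical_set_scope.

(* Partial recursive functions, presented as unary functions on nat by means
   of Cantor pairing; n-ary functions take coded tuples as arguments. *)

Definition pair_nat (x y : nat) : nat := Cantor.to_nat (x, y).

Inductive code : Type :=
| Zero
| Succ
| Fst
| Snd
| Pair of code & code
| Comp of code & code
| Prec of code & code
| Mu of code.

(* Primitive recursion with parameter a, on graphs:
   h(a, 0) = f(a),  h(a, n+1) = g(a, (n, h(a, n))). *)
Fixpoint prec_graph (f g : nat -> nat -> Prop) (a n y : nat) : Prop :=
  match n with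
  | 0 => f a y
  | m.+1 => exists2 z, prec_graph f g a m z & g (pair_nat a (pair_nat m z)) y
  end.

(* eval c x y: the computation of c on input x converges with output y.
   Mu f maps x to the least y such that f(x, y) = 0, provided that f(x, m)
   converges for all m < y. *)
Fixpoint eval (c : code) : nat -> nat -> Prop :=
  match c with
  | Zero => fun _ y => y = 0
  | Succ => fun x y => y = x.+1
  | Fst => fun x y => y = (Cantor.of_nat x).1
  | Snd => fun x y => y = (Cantor.of_nat x).2
  | Pair f g => fun x y =>
      exists u v, [/\ eval f x u, eval g x v & y = pair_nat u v]
  | Comp f g => fun x y => exists2 z, eval g x z & eval f z y
  | Prec f g => fun x y =>
      prec_graph (eval f) (eval g) (Cantor.of_nat x).1 (Cantor.of_nat x).2 y
  | Mu f => fun x y =>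
      eval f (pair_nat x y) 0 /\
      forall m, m < y -> exists k, eval f (pair_nat x m) k.+1
  end.

(* Goedel numbering: the number coding (t, p) stands for the code with
   constructor t and arguments coded by p. *)
Fixpoint encode (c : code) : nat :=
  match c with
  | Zero => pair_nat 0 0
  | Succ => pair_nat 1 0
  | Fst => pair_nat 2 0
  | Snd => pair_nat 3 0
  | Pair f g => pair_nat 4 (pair_nat (encode f) (encode g))
  | Comp f g => pair_nat 5 (pair_nat (encode f) (encode g))
  | Prec f g => pair_nat 6 (pair_nat (encode f) (encode g))
  | Mu f => pair_nat 7 (encode f)
  end.

(* The bound k on the recursion depth never matters when e < k, because
   p < e as soon as e codes (t, p) with t > 0. *)
Fixpoint decode_rec (k e : nat) : code :=
  match k with
  | 0 => Zero
  | k'.+1 =>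
    let: (t, p) := Cantor.of_nat e in
    let: (a, b) := Cantor.of_nat p in
    match t with
    | 0 => Zero
    | 1 => Succ
    | 2 => Fst
    | 3 => Snd
    | 4 => Pair (decode_rec k' a) (decode_rec k' b)
    | 5 => Comp (decode_rec k' a) (decode_rec k' b)
    | 6 => Prec (decode_rec k' a) (decode_rec k' b)
    | _ => Mu (decode_rec k' p)
    end
  end.

Definition decode (e : nat) : code := decode_rec e.+1 e.

(* phi e is the graph of the e-th partial computable function. *)
Definition phi (e : nat) : nat -> nat -> Prop := eval (decode e).

Definition W (e : nat) : set nat := [set x | exists y, phi e x y].

Definition computable (f : nat -> nat) : Prop :=
  exists e, forall x, phi e x (f x).

Definition ce (A : set nat) : Prop := exists e, A = W e.

Definition simple_set (A : set nat) : Prop :=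
  [/\ ce A, infinite_set (~` A) &
      forall B : set nat, ce B -> infinite_set B -> ~ (B `<=` ~` A)].

(* Disjointness is that of the indexed family: W (f m) and W (f n) are disjoint
   for m != n. Disjointness of distinct members only would admit constant
   sequences, and no proper subset of nat would be hyperhypersimple. *)
Definition hyperhypersimple (A : set nat) : Prop :=
  ce A /\
  forall f : nat -> nat, computable f ->
    (forall n, finite_set (W (f n))) ->
    trivIset setT (fun n => W (f n)) ->
    exists n, W (f n) `<=` A.

Definition collapse (A : set nat) (m n : nat) : Prop := m = n \/ (A m /\ A n).

Definition ceer (E : nat -> nat -> Prop) : Prop :=
  Equivalence E /\
  ce [set z | E (Cantor.of_nat z).1 (Cantor.of_nat z).2].

Definition reducible (E F : nat -> nat -> Prop) : Prop :=
  exists f, computable f /\ forall x y, E x y <-> F (f x) (f y).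

Definition bireducible (E F : nat -> nat -> Prop) : Prop :=
  reducible E F /\ reducible F E.

Definition eq_class (E : nat -> nat -> Prop) (x : nat) : set nat :=
  [set y | E x y].

Definition dark (E : nat -> nat -> Prop) : Prop :=
  [/\ ceer E, infinite_set (range (eq_class E)) & ~ reducible (@eq nat) E].

Definition eq_ce (e e' : nat) : Prop := W e = W e'.

Definition fs_jump (E : nat -> nat -> Prop) (e e' : nat) : Prop :=
  [set eq_class E y | y in [set y | exists n, phi e n y]] =
  [set eq_class E y | y in [set y | exists n, phi e' n y]].

Definition high_for_fs_jump (E : nat -> nat -> Prop) : Prop :=
  ceer E /\ bireducible (fs_jump E) eq_ce.

Lemma eval_functional c x y y' : eval c x y -> eval c x y' -> y = y'.
Proof.
elim: c x y y' => [||||f IHf g IHg|f IHf g IHg|f IHf g IHg|f IHf] x y y' /=;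
  try by move=> -> ->.
- move=> [u [v [fu gv ->]]] [u' [v' [fu' gv' ->]]].
  by rewrite (IHf _ _ _ fu fu') (IHg _ _ _ gv gv').
- move=> [z gz fy] [z' gz' fy']; rewrite (IHg _ _ _ gz gz') in fy.
  exact: IHf fy fy'.
- elim: (Cantor.of_nat x).2 y y' => [|n IHn] y y' /=; first exact: IHf.
  move=> [z hz gy] [z' hz' gy']; rewrite (IHn _ _ hz hz') in gy.
  exact: IHg gy gy'.
- move=> [fy ly] [fy' ly']; case: (ltngtP y y') => // lt.
  + by have [k fk] := ly' _ lt; have := IHf _ _ _ fy fk.
  + by have [k fk] := ly _ lt; have := IHf _ _ _ fy' fk.
Qed.

Lemma pair_nat_ge x y : x + y <= pair_nat x y.
Proof.
rewrite addnC; apply/leP; exact: Cantor.to_nat_non_decreasing.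
Qed.

Lemma decode_encode : cancel encode decode.
Proof.
suff H c k : encode c < k -> decode_rec k (encode c) = c by move=> c; exact: H.
elim: c k => [||||f IHf g IHg|f IHf g IHg|f IHf g IHg|f IHf] [|k] //;
  cbn [encode decode_rec]; rewrite /pair_nat ?Cantor.cancel_of_to //.
1-3: set p := Cantor.to_nat (encode f, encode g) => lt_k;
  have le1 := leq_ltn_trans (pair_nat_ge _ p) lt_k;
  have le2 : encode f + encode g <= p := pair_nat_ge _ _;
  rewrite IHf ?IHg //;
  [apply: leq_ltn_trans (leq_addl (encode f) _) _ | apply: leq_ltn_trans (leq_addr (encode g) _) _];
  by apply: leq_ltn_trans le2 _; rewrite addSn ltnS in le1; apply: leq_ltn_trans (leq_addl _ _) le1.
move=> lt_k; have le1 := leq_ltn_trans (pair_nat_ge 7 _) lt_k.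
case: (Cantor.of_nat _) => a b; rewrite IHf //.
by rewrite addSn ltnS in le1; apply: leq_ltn_trans (leq_addl _ _) le1.
Qed.

(* Main.v *)
(* If A is not hyperhypersimple, some computable f gives pairwise disjoint sets
   W_{f(n)}, none of which is contained in A.  Reduce =^ce to the jump of E_A by
   sending e to a program with range the union of the W_{f(n)} for n in W_e: its
   E_A-saturation contains a point of W_{f(n)} outside A if and only if n is in
   W_e.  The converse reduction sends e to an index of the E_A-saturation of the
   range of phi_e, which works for every ceer.  A reduction of id to E_A is
   injective and takes at most one value in A, so its other values would form an
   infinite c.e. subset of the complement of A.
   Semidecidability of the universal relation rests on finite certificates: phi
   is the only fixed point of a one-step unfolding operator, so phi_e(x) = y
   holds iff (e, x, y) lies in a finite set of triples each justified by it. *)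

Require Import Defs.
From mathcomp Require Import all_boot.
From mathcomp Require Import boolp classical_sets functions cardinality.
From Stdlib Require Import RelationClasses.
From Stdlib Require Cantor.

Set Implicit Arguments.
Unset Strict Implicit.
Unset Printing Implicit Defensive.

Local Open Scope classical_set_scope.

(** * Projections of the Cantor pairing *)

Definition pr1 (z : nat) : nat := (Cantor.of_nat z).1.
Definition pr2 (z : nat) : nat := (Cantor.of_nat z).2.

Lemma pr1_pair x y : pr1 (pair_nat x y) = x.
Proof. by rewrite /pr1 /pair_nat Cantor.cancel_of_to. Qed.

Lemma pr2_pair x y : pr2 (pair_nat x y) = y.
Proof. by rewrite /pr2 /pair_nat Cantor.cancel_of_to. Qed.

Lemma pair_pr z : pair_nat (pr1 z) (pr2 z) = z.
Proof. by rewrite /pair_nat /pr1 /pr2 -surjective_pairing Cantor.cancel_to_of. Qed.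

Definition prE := (pr1_pair, pr2_pair, pair_pr).

Lemma pr_add_le z : pr1 z + pr2 z <= z.
Proof. by rewrite -{3}(pair_pr z); exact: pair_nat_ge. Qed.

Lemma pr1_le z : pr1 z <= z.
Proof. exact: leq_trans (leq_addr _ _) (pr_add_le z). Qed.

Lemma pr2_le z : pr2 z <= z.
Proof. exact: leq_trans (leq_addl _ _) (pr_add_le z). Qed.

(** * Computable functions *)

Lemma computableP f : computable f <-> exists c, forall x, eval c x (f x).
Proof.
split=> [[e fE]|[c fE]]; first by exists (decode e).
by exists (encode c) => x; rewrite /phi decode_encode.
Qed.

Lemma computable_pair f g : computable f -> computable g ->
  computable (fun x => pair_nat (f x) (g x)).
Proof.
move=> /computableP[c fE] /computableP[d gE]; apply/computableP.
by exists (Pair c d) => x; exists (f x), (g x).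
Qed.

Lemma computable_comp f g : computable f -> computable g ->
  computable (fun x => f (g x)).
Proof.
move=> /computableP[c fE] /computableP[d gE]; apply/computableP.
by exists (Comp c d) => x; exists (g x).
Qed.

Lemma computable_pr1 f : computable f -> computable (fun x => pr1 (f x)).
Proof. by apply: computable_comp; apply/computableP; exists Fst. Qed.

Lemma computable_pr2 f : computable f -> computable (fun x => pr2 (f x)).
Proof. by apply: computable_comp; apply/computableP; exists Snd. Qed.

Lemma computable_succ f : computable f -> computable (fun x => (f x).+1).
Proof. by apply: computable_comp; apply/computableP; exists Succ. Qed.

(** The pairing is onto, so pairing the two projections again gives the identity. *)
Definition Id : code := Pair Fst Snd.

Lemma eval_Id x y : eval Id x y <-> y = x.
Proof.
split=> [/=[u [v [-> -> ->]]]|->]; first exact: pair_pr.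
by exists (pr1 x), (pr2 x); rewrite pair_pr.
Qed.

Lemma computable_id : computable (fun x => x).
Proof. by apply/computableP; exists Id => x; apply/eval_Id. Qed.

Lemma computable_const n : computable (fun _ => n).
Proof.
elim: n => [|n]; first by apply/computableP; exists Zero.
exact: computable_succ.
Qed.

Lemma computable_rec (f : nat -> nat) (g : nat -> nat -> nat -> nat) n :
  computable f -> computable n ->
  computable (fun z => g (pr1 z) (pr1 (pr2 z)) (pr2 (pr2 z))) ->
  computable (fun x => nat_rec (fun=> nat) (f x) (g x) (n x)).
Proof.
move=> /computableP[c fE] nC /computableP[d gE].
(* [Prec] reads parameter and counter from one coded pair; composing with [x |-> (x, n x)] then
   makes the depth depend on [x]. *)
have recC : computable
    (fun z => nat_rec (fun=> nat) (f (pr1 z)) (g (pr1 z)) (pr2 z)).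
  apply/computableP; exists (Prec c d) => z /=; rewrite -/(pr1 z) -/(pr2 z).
  elim: (pr2 z) => [|m IHm] //=; eexists; first exact: IHm.
  by have := gE (pair_nat (pr1 z) (pair_nat m
    (nat_rec (fun=> nat) (f (pr1 z)) (g (pr1 z)) m))); rewrite !prE.
have := computable_comp recC (computable_pair computable_id nC).
by congr computable; apply/funext => x; rewrite !prE.
Qed.

(** Case analysis is a primitive recursion whose step ignores the previous value. *)
Lemma computable_case f g n : computable f -> computable n ->
  computable (fun z => g (pr1 z) (pr2 z)) ->
  computable (fun x => match n x with 0 => f x | m.+1 => g x m end).
Proof.
move=> fC nC gC.
have gC' : computable (fun z => g (pr1 z) (pr1 (pr2 z))).
  have pC := computable_pair (computable_pr1 computable_id)
    (computable_pr1 (computable_pr2 computable_id)).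
  have := computable_comp gC pC.
  by congr computable; apply/funext => x; rewrite !prE.
have := computable_rec (g := fun x m _ => g x m) fC nC gC'.
by congr computable; apply/funext => x; case: (n x).
Qed.

Ltac computability := cbv beta;
  match goal with
  | H : computable ?f |- computable ?f => exact: H
  | |- computable (fun x => x) => exact: computable_id
  | |- computable (fun _ => ?n) => exact: computable_const
  | |- computable id => exact: computable_id
  | |- computable pr1 => exact: computable_pr1 computable_id
  | |- computable pr2 => exact: computable_pr2 computable_id
  | |- computable (fun x => pr1 (@?f x)) => apply (@computable_pr1 f); computability
  | |- computable (fun x => pr2 (@?f x)) => apply (@computable_pr2 f); computability
  | |- computable (fun x => S (@?f x)) => apply (@computable_succ f); computability
  | |- computable (fun x => pair_nat (@?f x) (@?g x)) =>
      apply (@computable_pair f g); computability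
  | H : computable ?f |- computable (fun x => ?f (@?g x)) =>
      apply (@computable_comp f g H); computability
  end.

Lemma computable_sub f g : computable f -> computable g ->
  computable (fun x => f x - g x).
Proof.
move=> fC gC.
have predC : computable predn.
  by apply: (@computable_case id (fun _ m => m) id); computability.
have := computable_rec (g := fun _ _ r => r.-1) fC gC.
have -> : (fun x => nat_rec (fun=> nat) (f x) (fun _ r => r.-1) (g x)) =
    (fun x => f x - g x).
  apply/funext => x; elim: (g x) => [|m IHm] /=; first by rewrite subn0.
  by rewrite IHm subnS.
by apply; computability.
Qed.

(** * Recursive predicates *)

(** Classical [asbool] gives every predicate a truth value; the content lies in its being computable
    from [x]. *)
Definition recursive (P : nat -> Prop) : Prop :=
  computable (fun x => nat_of_bool `[< P x >]).

Lemma recursive_ext P Q : (forall x, P x <-> Q x) -> recursive P -> recursive Q.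
Proof. by move=> PQ; congr recursive; apply/funext => x; apply/propext. Qed.

Lemma recursive_comp P f : recursive P -> computable f ->
  recursive (fun x => P (f x)).
Proof. exact: computable_comp. Qed.

Lemma recursive_case P Q n : recursive P -> computable n ->
  recursive (fun z => Q (pr1 z) (pr2 z)) ->
  recursive (fun x => match n x with 0 => P x | m.+1 => Q x m end).
Proof.
move=> PR nC QR; have := computable_case
  (g := fun x m => nat_of_bool `[< Q x m >]) PR nC QR.
by congr computable; apply/funext => x; case: (n x).
Qed.

(** With constant branches this definition by cases yields all Boolean connectives. *)
Lemma recursive_cases P Q R : recursive P -> recursive Q -> recursive R ->
  recursive (fun x => P x /\ Q x \/ ~ P x /\ R x).
Proof.
move=> PR QR RR; have QR' : recursive (fun z => Q (pr1 z)).
  by apply: recursive_comp => //; computability.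
have := @recursive_case R (fun x _ => Q x) _ RR PR QR'.
by apply: recursive_ext => x; case: asboolP; tauto.
Qed.

Lemma recursive_True : recursive (fun _ => True).
Proof. exact: computable_const. Qed.

Lemma recursive_False : recursive (fun _ => False).
Proof. exact: computable_const. Qed.

Lemma recursive_and P Q : recursive P -> recursive Q ->
  recursive (fun x => P x /\ Q x).
Proof.
move=> PR QR; have := recursive_cases PR QR recursive_False.
by apply: recursive_ext; tauto.
Qed.

Lemma recursive_not P : recursive P -> recursive (fun x => ~ P x).
Proof.
move=> PR; have := recursive_cases PR recursive_False recursive_True.
by apply: recursive_ext; tauto.
Qed.

Lemma recursive_or P Q : recursive P -> recursive Q ->
  recursive (fun x => P x \/ Q x).
Proof.
move=> PR QR; have := recursive_cases PR recursive_True QR.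
by apply: recursive_ext => x; have [] := pselect (P x); tauto.
Qed.

Lemma recursive_le f g : computable f -> computable g ->
  recursive (fun x => f x <= g x).
Proof.
move=> fC gC; have subC := computable_sub fC gC.
have := @recursive_case (fun _ => True) (fun _ _ => False) _
  recursive_True subC recursive_False.
by apply: recursive_ext => x; rewrite -subn_eq0; case: (f x - g x).
Qed.

Lemma recursive_eq f g : computable f -> computable g ->
  recursive (fun x => f x = g x).
Proof.
move=> fC gC; have := recursive_and (recursive_le fC gC) (recursive_le gC fC).
apply: recursive_ext => x; split=> [[le ge]|->]; last by rewrite leqnn.
by apply/eqP; rewrite eqn_leq le.
Qed.

Lemma recursive_forall_lt P b : recursive (fun z => P (pr1 z) (pr2 z)) ->
  computable b -> recursive (fun x => forall i, i < b x -> P x i).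
Proof.
move=> PR bC.
(* The recursion carries a running truth value, starting at 1 for the empty range and dropping to 0
   for good at the first failure. *)
pose g x i r := match nat_of_bool `[< P x i >] with 0 => 0 | _.+1 => r end.
have P'C : computable (fun z => nat_of_bool `[< P (pr1 z) (pr1 (pr2 z)) >]).
  have pC : computable (fun z => pair_nat (pr1 z) (pr1 (pr2 z))).
    by computability.
  have := recursive_comp PR pC.
  by congr computable; apply/funext => x; rewrite !prE.
have gC : computable (fun z => g (pr1 z) (pr1 (pr2 z)) (pr2 (pr2 z))).
  by apply: computable_case => //; computability.
have := computable_rec (computable_const 1) bC gC.
congr computable; apply/funext => x.
elim: (b x) => [|n IHn] /=; first by case: asboolP => // -[].
rewrite IHn /g; case: (asboolP (P x n)) => Pn /=; last first.
  by case: asboolP => // /(_ n (ltnSn n)).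
congr nat_of_bool; apply/asbool_equiv_eq; split=> Pi i lt_i.
  by move: lt_i; rewrite ltnS leq_eqVlt => /predU1P[->|/Pi].
by apply: Pi; exact: ltnW.
Qed.

(** Every witness lies below [b x], so the existential is the negation of a bounded universal. *)
Lemma recursive_exists_bounded P b : recursive (fun z => P (pr1 z) (pr2 z)) ->
  computable b -> (forall x i, P x i -> i < b x) ->
  recursive (fun x => exists i, P x i).
Proof.
move=> PR bC Pb; have := recursive_not
  (recursive_forall_lt (P := fun x i => ~ P x i) (recursive_not PR) bC).
apply: recursive_ext => x; split=> [nP|[i Pi] nP]; last exact: nP (Pb _ _ Pi) Pi.
by apply: contrapT => nE; apply: nP => i _ Pi; apply: nE; exists i.
Qed.

(** * Semidecidable predicates *)

Definition sigma1 (P : nat -> Prop) : Prop :=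
  exists2 R, recursive R & forall x, P x <-> exists w, R (pair_nat x w).

Lemma sigma1_ext P Q : (forall x, P x <-> Q x) -> sigma1 P -> sigma1 Q.
Proof. by move=> PQ; congr sigma1; apply/funext => x; apply/propext. Qed.

Lemma recursive_sigma1 P : recursive P -> sigma1 P.
Proof.
move=> PR; exists (fun z => P (pr1 z)).
  by apply: recursive_comp => //; computability.
by move=> x; split=> [Px|[w]]; [exists 0|]; rewrite !prE.
Qed.

Lemma sigma1_and P Q : sigma1 P -> sigma1 Q -> sigma1 (fun x => P x /\ Q x).
Proof.
move=> [R RR PE] [S SR QE].
exists (fun z => R (pair_nat (pr1 z) (pr1 (pr2 z))) /\
                 S (pair_nat (pr1 z) (pr2 (pr2 z)))).
  by apply: recursive_and; apply: recursive_comp => //; computability.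
move=> x; rewrite PE QE; split=> [[[u Ru] [v Sv]]|[w]].
  by exists (pair_nat u v); rewrite !prE.
by rewrite !prE => -[Ru Sv]; split; eexists; eassumption.
Qed.

Lemma sigma1_or P Q : sigma1 P -> sigma1 Q -> sigma1 (fun x => P x \/ Q x).
Proof.
move=> [R RR PE] [S SR QE]; exists (fun z => R z \/ S z).
  exact: recursive_or.
move=> x; rewrite PE QE; split=> [[[w]|[w]]|[w []]].
- by exists w; left.
- by exists w; right.
- by left; exists w.
- by right; exists w.
Qed.

(** The quantified number and the witness for its instance merge into one coded pair. *)
Lemma sigma1_exists (P : nat -> nat -> Prop) :
  sigma1 (fun z => P (pr1 z) (pr2 z)) -> sigma1 (fun x => exists n, P x n).
Proof.
move=> [R RR PE].
exists (fun z => R (pair_nat (pair_nat (pr1 z) (pr1 (pr2 z))) (pr2 (pr2 z)))).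
  by apply: recursive_comp => //; computability.
move=> x; split=> [[n Pn]|[w]].
  have [|w Rw] := (PE (pair_nat x n)).1; first by rewrite !prE.
  by exists (pair_nat n w); rewrite !prE.
rewrite !prE => Rw; exists (pr1 w).
by have := (PE (pair_nat x (pr1 w))).2; rewrite !prE; apply; eexists; exact: Rw.
Qed.

Lemma sigma1_domain P : sigma1 P ->
  exists c, forall x, P x <-> exists y, eval c x y.
Proof.
move=> [R RR PE].
(* [Mu] searches for a zero, so it is applied to the characteristic function of the negation of
   [R]. *)
have [c cE] := (computableP _).1 (recursive_not RR).
exists (Mu c) => x; rewrite PE; split=> [exR|[w [/= cw _]]]; last first.
  exists w; apply: contrapT => nR; have := eval_functional cw (cE _).
  by case: asboolP.
have exb : exists w, `[< R (pair_nat x w) >].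
  by have [w Rw] := exR; exists w; apply/asboolP.
case: (ex_minnP exb) => w /asboolP Rw min; exists w; split=> /=.
  by have := cE (pair_nat x w); case: asboolP.
(* Below the least witness the characteristic function has value 1, that is [k.+1] with [k = 0]. *)
move=> m lt_m; exists 0; have := cE (pair_nat x m); case: asboolP => //.
by move=> /contrapT Rm; move: lt_m; rewrite ltnNge min //; apply/asboolP.
Qed.

(** * Programs with a parameter built in, and the s-m-n theorem *)

Fixpoint const_code (n : nat) : code :=
  if n is m.+1 then Comp Succ (const_code m) else Zero.

Lemma eval_const_code n x y : eval (const_code n) x y <-> y = n.
Proof.
elim: n y => [|n IHn] y //=; split=> [[z /IHn -> ->]|->] //.
by exists n => //; apply/IHn.
Qed.

Lemma computable_const_code : computable (fun n => encode (const_code n)).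
Proof.
(* Here 5 is the tag of [Comp], while [pair_nat 1 0] and [pair_nat 0 0] are the codes of [Succ] and
   [Zero]. *)
have := @computable_rec (fun _ => pair_nat 0 0)
  (fun _ _ r => pair_nat 5 (pair_nat (pair_nat 1 0) r)) id.
have -> : (fun x => nat_rec (fun=> nat) (pair_nat 0 0)
    (fun _ r => pair_nat 5 (pair_nat (pair_nat 1 0) r)) (id x)) =
    (fun n => encode (const_code n)).
  by apply/funext; elim=> [|n IHn] //=; rewrite -IHn.
by apply; computability.
Qed.

(* The s-m-n theorem; the program indexed by g e returns its own input, so that
   its domain and its range are both {x | P (e, x)}. *)
Lemma sigma1_smn P : sigma1 P -> exists2 g, computable g &
  forall e x y, phi (g e) x y <-> y = x /\ P (pair_nat e x).
Proof.
move=> /sigma1_domain[c cE].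
(* On input [x] this runs [c] on [(e, x)] only for its convergence: the outer [Fst] discards the
   value and keeps [x]. *)
pose d e := Comp Fst (Pair Id (Comp c (Pair (const_code e) Id))).
exists (fun e => encode (d e)).
  have kC := computable_const_code.
  by rewrite /d; cbn [encode]; computability.
move=> e x y; rewrite /phi decode_encode cE /d.
split=> [[z [u [v [/eval_Id -> [w [n [m [en em ->]]] cv ->]]] ->]]|[-> [v cv]]].
  move: en em => /eval_const_code ne /eval_Id mx; rewrite ne mx in cv.
  by rewrite -/(pr1 _) prE; split=> //; exists v.
exists (pair_nat x v); last by rewrite /= -/(pr1 _) prE.
exists x, v; split=> //; first exact/eval_Id.
exists (pair_nat e x) => //; exists e, x; split=> //.
  exact/eval_const_code.
exact/eval_Id.
Qed.

Lemma sigma1_ce (P : set nat) : sigma1 P -> ce P.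
Proof.
move=> /sigma1_domain[c cE]; exists (encode c); apply/seteqP.
by rewrite /W /phi decode_encode; split=> x /= /cE.
Qed.

(** * The universal relation is semidecidable *)

(* One unfolding of the evaluation relation, read directly on indices. *)
Definition step (D : nat -> nat -> nat -> Prop) (e x y : nat) : Prop :=
  match pr1 e with
  | 0 => y = 0
  | 1 => y = x.+1
  | 2 => y = pr1 x
  | 3 => y = pr2 x
  | 4 => D (pr1 (pr2 e)) x (pr1 y) /\ D (pr2 (pr2 e)) x (pr2 y)
  | 5 => exists z, D (pr2 (pr2 e)) x z /\ D (pr1 (pr2 e)) z y
  | 6 => match pr2 x with
         | 0 => D (pr1 (pr2 e)) (pr1 x) y
         | n.+1 => exists z, D e (pair_nat (pr1 x) n) z /\
                     D (pr2 (pr2 e)) (pair_nat (pr1 x) (pair_nat n z)) y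
         end
  | _ => D (pr2 e) (pair_nat x y) 0 /\
         forall m, m < y -> exists k, D (pr2 e) (pair_nat x m) k.+1
  end.

Lemma pr2_lt e : 0 < pr1 e -> pr2 e < e.
Proof.
by move=> e_gt0; apply: leq_trans (pr_add_le e); rewrite -addn1 addnC leq_add2r.
Qed.

(** For a nonzero tag the recursive calls concern numbers below [e], so any fuel exceeding [e]
    suffices; tag 0 makes no call. *)
Lemma decode_rec_bound k l e : e < k -> e < l -> decode_rec k e = decode_rec l e.
Proof.
elim: k l e => [//|k IHk] [//|l] e lt_k lt_l; cbn [decode_rec].
have lt_p : 0 < pr1 e -> pr2 e < k /\ pr2 e < l.
  by move=> /pr2_lt lt_e; split; apply: leq_trans lt_e _.
move: lt_p; rewrite /pr1 /pr2; case: (Cantor.of_nat e) => t p /=.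
move: (pr1_le p) (pr2_le p); rewrite /pr1 /pr2.
case: (Cantor.of_nat p) => a b /= a_le b_le.
case: t => // t /(_ isT)[pk pl].
have aE := IHk l a (leq_ltn_trans a_le pk) (leq_ltn_trans a_le pl).
have bE := IHk l b (leq_ltn_trans b_le pk) (leq_ltn_trans b_le pl).
by rewrite aE bE (IHk l p).
Qed.

Lemma decode_eq e : decode e =
  match pr1 e with
  | 0 => Zero
  | 1 => Succ
  | 2 => Fst
  | 3 => Snd
  | 4 => Pair (decode (pr1 (pr2 e))) (decode (pr2 (pr2 e)))
  | 5 => Comp (decode (pr1 (pr2 e))) (decode (pr2 (pr2 e)))
  | 6 => Prec (decode (pr1 (pr2 e))) (decode (pr2 (pr2 e)))
  | _ => Mu (decode (pr2 e))
  end.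
Proof.
have dE a : a < e -> decode_rec e a = decode a.
  by move=> lt_a; apply: decode_rec_bound.
have lt_p := @pr2_lt e.
have lt_a h : pr1 (pr2 e) < e := leq_ltn_trans (pr1_le _) (lt_p h).
have lt_b h : pr2 (pr2 e) < e := leq_ltn_trans (pr2_le _) (lt_p h).
rewrite {1}/decode; cbn [decode_rec].
rewrite (surjective_pairing (Cantor.of_nat e)) -/(pr1 e) -/(pr2 e).
rewrite (surjective_pairing (Cantor.of_nat (pr2 e))).
rewrite -/(pr1 (pr2 e)) -/(pr2 (pr2 e)).
case: (pr1 e) lt_p lt_a lt_b => [|t] //.
by move=> /(_ isT)/dE -> /(_ isT)/dE -> /(_ isT)/dE ->.
Qed.

Lemma phi_step e x y : phi e x y <-> step phi e x y.
Proof.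
have := decode_eq e; rewrite /step.
case: (pr1 e) => [|[|[|[|[|[|[|t]]]]]]] eE; rewrite {1}/phi eE //=.
- split=> [[u [v [au bv ->]]]|[au bv]]; first by rewrite !prE.
  by exists (pr1 y), (pr2 y); rewrite prE.
- by split=> [[z bz az]|[z [bz az]]]; exists z.
(* With tag 6, [step] refers back to [e] itself at the preceding counter, so the graph of the
   recursion has to be recognised as [phi e]. *)
- have phi_e a n z : phi e (pair_nat a n) z <->
      prec_graph (phi (pr1 (pr2 e))) (phi (pr2 (pr2 e))) a n z.
    by rewrite {1}/phi eE /= -/(pr1 _) -/(pr2 _) !prE.
  rewrite -/(pr1 x) -/(pr2 x); case: (pr2 x) => [|n] //=.
  by split=> [[z /phi_e ez bz]|[z [/phi_e ez bz]]]; exists z.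
Qed.

(** * The computation relation as the unique fixed point of [step] *)

Definition smaller (e' x' e x : nat) : Prop :=
  e' < e \/ e' = e /\ pr2 x' < pr2 x.

(** The order is lexicographic in the index and the recursion counter [pr2 x], hence two nested
    strong inductions. *)
Lemma smaller_ind (P : nat -> nat -> Prop) :
  (forall e x, (forall e' x', smaller e' x' e x -> P e' x') -> P e x) ->
  forall e x, P e x.
Proof.
move=> IH e; elim/ltn_ind: e => e IHe x.
have [n] := ubnP (pr2 x); elim: n x => // n IHn x lt_n.
apply: IH => e' x' [lt_e|[-> lt_x]]; first exact: IHe.
by apply: IHn; exact: leq_trans lt_x _.
Qed.

(** Subprograms have smaller indices, and primitive recursion calls its own index only at a smaller
    counter. *)
Lemma step_smaller (D D' : nat -> nat -> nat -> Prop) e x y :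
  (forall e' x' y', smaller e' x' e x -> D e' x' y' -> D' e' x' y') ->
  step D e x y -> step D' e x y.
Proof.
move=> DD'; rewrite /step.
have [e0|e_gt0] := posnP (pr1 e); first by rewrite e0.
have Dp x' y' : D (pr2 e) x' y' -> D' (pr2 e) x' y'.
  by apply: DD'; left; exact: pr2_lt.
have Da x' y' : D (pr1 (pr2 e)) x' y' -> D' (pr1 (pr2 e)) x' y'.
  by apply: DD'; left; exact: leq_ltn_trans (pr1_le _) (pr2_lt e_gt0).
have Db x' y' : D (pr2 (pr2 e)) x' y' -> D' (pr2 (pr2 e)) x' y'.
  by apply: DD'; left; exact: leq_ltn_trans (pr2_le _) (pr2_lt e_gt0).
case: (pr1 e) => [|[|[|[|[|[|[|t]]]]]]] //.
- by move=> [/Da ? /Db].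
- by move=> [z [/Db bz /Da az]]; exists z.
- case xE: (pr2 x) => [|n]; first exact: Da.
  move=> [z [ez /Db bz]]; exists z; split=> //.
  by apply: DD' ez; right; rewrite prE xE.
- move=> [/Dp p0 pm]; split=> // m /pm[k /Dp]; by exists k.
Qed.

Lemma step_mono (D D' : nat -> nat -> nat -> Prop) e x y :
  (forall e' x' y', D e' x' y' -> D' e' x' y') ->
  step D e x y -> step D' e x y.
Proof. by move=> DD'; apply: step_smaller => e' x' y' _; exact: DD'. Qed.

Lemma phi_least (D : nat -> nat -> nat -> Prop) :
  (forall e x y, step D e x y -> D e x y) ->
  forall e x y, phi e x y -> D e x y.
Proof.
move=> DD; apply: smaller_ind => e x IH y /phi_step ey; apply: DD.
by apply: step_smaller ey => e' x' y' /IH; apply.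
Qed.

Definition closed (D : nat -> nat -> nat -> Prop) : Prop :=
  forall e x y, D e x y -> step D e x y.

(** Since [step] consults only smaller pairs, facts cannot support each other in a circle. This is
    the soundness of certificates. *)
Lemma phi_greatest (D : nat -> nat -> nat -> Prop) :
  closed D -> forall e x y, D e x y -> phi e x y.
Proof.
move=> DD; apply: smaller_ind => e x IH y /DD ey; apply/phi_step.
by apply: step_smaller ey => e' x' y' /IH; apply.
Qed.

(** * Finite certificates for computations *)

Definition fact (e x y : nat) : nat := pair_nat e (pair_nat x y).

Definition listed (s : seq nat) (e x y : nat) : Prop := fact e x y \in s.

Definition derivable (e x y : nat) : Prop :=
  exists2 s, closed (listed s) & listed s e x y.

Lemma factI e x y e' x' y' : fact e x y = fact e' x' y' ->
  [/\ e = e', x = x' & y = y'].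
Proof.
move=> E; have := congr1 pr1 E; have := congr1 pr2 E; rewrite !prE => E2 ->.
by have := congr1 pr1 E2; have := congr1 pr2 E2; rewrite !prE => -> ->.
Qed.

Lemma closed_cat s s' : closed (listed s) -> closed (listed s') ->
  closed (listed (s ++ s')).
Proof.
move=> cs cs' e x y; rewrite /listed mem_cat => /orP[/cs es|/cs' es];
  by apply: step_mono es => *; rewrite /listed mem_cat; apply/orP; auto.
Qed.

Lemma closed_cons s e x y : closed (listed s) -> step (listed s) e x y ->
  closed (listed (fact e x y :: s)).
Proof.
move=> cs es.
have sub e' x' y' : listed s e' x' y' -> listed (fact e x y :: s) e' x' y'.
  by move=> sy; rewrite /listed in_cons; apply/orP; right.
move=> e' x' y'; rewrite {1}/listed in_cons => /predU1P[/factI[-> -> ->]|/cs es'].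
  exact: step_mono es.
exact: step_mono es'.
Qed.

(** The trials of a search below [y] are finitely many; concatenating their certificates serves all
    of them at once. *)
Lemma derivable_prefix p (y : nat) (v : nat -> nat) :
  (forall m, m < y -> exists k, derivable p (v m) k.+1) ->
  exists2 s, closed (listed s) &
    forall m, m < y -> exists k, listed s p (v m) k.+1.
Proof.
elim: y => [|y IHy] der; first by exists [::].
have [m lt_m|s cs sP] := IHy; first exact/der/ltnW.
have [k [s' cs' s'k]] := der y (ltnSn y).
exists (s ++ s') => [|m]; first exact: closed_cat.
rewrite ltnS leq_eqVlt /listed => /predU1P[->|/sP[l sl]].
  by exists k; rewrite mem_cat; apply/orP; right.
by exists l; rewrite mem_cat; apply/orP; left.
Qed.

Lemma derivable2 e x y e' x' y' : derivable e x y -> derivable e' x' y' ->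
  exists s, [/\ closed (listed s), listed s e x y & listed s e' x' y'].
Proof.
move=> [s cs sy] [s' cs' sy']; exists (s ++ s'); split; first exact: closed_cat.
  by rewrite /listed mem_cat; apply/orP; left.
by rewrite /listed mem_cat; apply/orP; right.
Qed.

(** One step uses finitely many facts: join their certificates and put the new fact in front. *)
Lemma step_derivable e x y : step derivable e x y -> derivable e x y.
Proof.
move=> der.
suff [s cs es] : exists2 s, closed (listed s) & step (listed s) e x y.
  by exists (fact e x y :: s); [exact: closed_cons|rewrite /listed in_cons eqxx].
move: der; rewrite /step; case: (pr1 e) => [|[|[|[|[|[|[|t]]]]]]].
1-4: by exists [::].
- by move=> [du dv]; have [s [cs su sv]] := derivable2 du dv; exists s.
- move=> [z [dz dy]]; have [s [cs sz sy]] := derivable2 dz dy.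
  by exists s => //; exists z.
- case: (pr2 x) => [[s cs sy]|n [z [dz dy]]]; first by exists s.
  by have [s [cs sz sy]] := derivable2 dz dy; exists s => //; exists z.
- move=> [[s cs s0] /derivable_prefix[s' cs' s'P]].
  exists (s ++ s'); first exact: closed_cat.
  rewrite /listed; split; first by rewrite mem_cat; apply/orP; left.
  move=> m /s'P[k sk]; exists k; by rewrite mem_cat; apply/orP; right.
Qed.

Lemma phi_derivable e x y : phi e x y <-> derivable e x y.
Proof.
split; first by apply: phi_least; exact: step_derivable.
by move=> [s cs]; exact: phi_greatest.
Qed.

(** * Certificates coded as numbers, and their decidability *)

Definition nth_code (w i : nat) : nat :=
  pr1 (nat_rec (fun=> nat) (pr2 w) (fun=> pr2) i).

(* Finite lists are coded as (length, (s_0, (s_1, ...))). *)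
Definition list_code (s : seq nat) : nat :=
  pair_nat (size s) (foldr pair_nat 0 s).

(** Every [w] counts as a list; the bound on [i] excludes what [nth_code] returns past the end. *)
Definition coded (w e x y : nat) : Prop :=
  exists i, i < pr1 w /\ nth_code w i = fact e x y.

Lemma nth_list_code s i : i < size s -> nth_code (list_code s) i = nth 0 s i.
Proof.
rewrite /nth_code /list_code prE => lt_i.
have -> : nat_rec (fun=> nat) (foldr pair_nat 0 s) (fun=> pr2) i =
    foldr pair_nat 0 (drop i s).
  elim: i lt_i => [|i IHi] lt_i /=; first by rewrite drop0.
  by rewrite IHi ?(drop_nth 0 (ltnW lt_i)) /= ?prE // ltnW.
by rewrite (drop_nth 0 lt_i) /= prE.
Qed.

Lemma coded_list_code s : coded (list_code s) = listed s.
Proof.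
apply/funext => e; apply/funext => x; apply/funext => y; apply/propext.
rewrite /coded /listed {1}/list_code prE; split=> [[i [lt_i]]|].
  by rewrite nth_list_code // => <-; exact: mem_nth.
by move=> /(nthP 0)[i lt_i <-]; exists i; rewrite nth_list_code.
Qed.

(** Projections never increase a number. The bound makes the search for intermediate values in
    [step] finite. *)
Lemma coded_lt w e x y : coded w e x y -> y < w.+1.
Proof.
move=> [i [_ E]]; have -> : y = pr2 (pr2 (nth_code w i)) by rewrite E !prE.
rewrite ltnS; do 2 apply: leq_trans (pr2_le _) _; apply: leq_trans (pr1_le _) _.
by elim: i {E} => [|i IHi] /=; [exact: pr2_le|exact: leq_trans (pr2_le _) IHi].
Qed.

Lemma phi_coded e x y :
  phi e x y <-> exists w, closed (coded w) /\ coded w e x y.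
Proof.
split=> [/phi_derivable[s cs sy]|[w [cw]]]; last exact: phi_greatest.
by exists (list_code s); rewrite coded_list_code.
Qed.

Lemma computable_nth_code w i : computable w -> computable i ->
  computable (fun x => nth_code (w x) (i x)).
Proof.
move=> wC iC; apply: computable_pr1.
apply: (@computable_rec (fun x => pr2 (w x)) (fun _ _ r => pr2 r) i);
  by computability.
Qed.

Lemma recursive_coded w e x y : computable w -> computable e ->
  computable x -> computable y ->
  recursive (fun z => coded (w z) (e z) (x z) (y z)).
Proof.
move=> wC eC xC yC; rewrite /coded.
apply: (@recursive_exists_bounded _ (fun z => pr1 (w z))).
- apply: recursive_and; first by apply: recursive_le; computability.
  apply: recursive_eq; last by rewrite /fact; computability.
  by apply: computable_nth_code; computability.
- by computability.
- by move=> z i [].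
Qed.

Lemma recursive_step_coded w e x y : computable w -> computable e ->
  computable x -> computable y ->
  recursive (fun z => step (coded (w z)) (e z) (x z) (y z)).
Proof.
move=> wC eC xC yC; rewrite /step.
do 4![apply: recursive_case; [by apply: recursive_eq; computability|
  by computability|]].
apply: recursive_case; [|computability|].
  by apply: recursive_and; apply: recursive_coded; computability.
apply: recursive_case; [|computability|].
  (* Each case distinction passed, and below also each bound variable, pairs the argument once more;
     the nested [pr1] undo this to reach the original argument of [w]. *)
  apply: (@recursive_exists_bounded _
    (fun z => (w (pr1 (pr1 (pr1 (pr1 (pr1 z)))))).+1)).
  - by apply: recursive_and; apply: recursive_coded; computability.
  - by computability.
  - by move=> z i [/coded_lt].
apply: recursive_case; [|computability|].
  apply: recursive_case; [|computability|].
    by apply: recursive_coded; computability.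
  apply: (@recursive_exists_bounded _
    (fun z => (w (pr1 (pr1 (pr1 (pr1 (pr1 (pr1 (pr1 z)))))))).+1)).
  - by apply: recursive_and; apply: recursive_coded; computability.
  - by computability.
  - by move=> z i [/coded_lt].
apply: recursive_and; first by apply: recursive_coded; computability.
apply: recursive_forall_lt; last by computability.
apply: (@recursive_exists_bounded _
  (fun z => (w (pr1 (pr1 (pr1 (pr1 (pr1 (pr1 (pr1 (pr1 z))))))))).+1)).
- by apply: recursive_coded; computability.
- by computability.
- by move=> z i /coded_lt /ltnW.
Qed.

(** Quantifying over all facts of the certificate amounts to quantifying over the positions in the
    list, which is bounded. *)
Lemma recursive_closed_coded w : computable w ->
  recursive (fun z => closed (coded (w z))).
Proof.
move=> wC.
have : recursive (fun z => forall i, i < pr1 (w z) ->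
    step (coded (w z)) (pr1 (nth_code (w z) i)) (pr1 (pr2 (nth_code (w z) i)))
      (pr2 (pr2 (nth_code (w z) i)))).
  apply: recursive_forall_lt; last by computability.
  have nC : computable (fun z => nth_code (w (pr1 z)) (pr2 z)).
    by apply: computable_nth_code; computability.
  by apply: recursive_step_coded; computability.
apply: recursive_ext => z; split=> [cw e x y [i [/cw + iE]]|cw i lt_i].
  by rewrite iE /fact !prE.
by apply: cw; exists i; rewrite /fact !prE.
Qed.

Lemma sigma1_phi e x y : computable e -> computable x -> computable y ->
  sigma1 (fun z => phi (e z) (x z) (y z)).
Proof.
move=> eC xC yC.
apply: sigma1_ext (fun z => iff_sym (phi_coded (e z) (x z) (y z))) _.
apply: sigma1_exists; apply: recursive_sigma1; apply: recursive_and.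
  by apply: recursive_closed_coded; computability.
by apply: recursive_coded; computability.
Qed.

Lemma sigma1_W e x : computable e -> computable x ->
  sigma1 (fun z => W (e z) (x z)).
Proof.
by move=> eC xC; apply: sigma1_exists; apply: sigma1_phi; computability.
Qed.
(** * Jumps of ceers *)

Definition saturation (E : nat -> nat -> Prop) (B : set nat) : set nat :=
  [set y | exists2 z, B z & E z y].

(** A class belongs to the family exactly when its points lie in the saturation. The jump thereby
    becomes a comparison of sets of numbers. *)
Lemma eq_class_image E B B' : Equivalence E ->
  [set eq_class E y | y in B] = [set eq_class E y | y in B'] <->
  saturation E B = saturation E B'.
Proof.
move=> EE; have classE z y : E z y -> eq_class E z = eq_class E y.
  move=> zy; apply/seteqP; split=> t /= zt; last exact: Equivalence_Transitive zy zt.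
  exact: Equivalence_Transitive (Equivalence_Symmetric _ _ zy) zt.
have sub C C' : [set eq_class E y | y in C] `<=` [set eq_class E y | y in C'] <->
    saturation E C `<=` saturation E C'.
  split=> CC' y [z Cz].
    move=> zy; have [|z' C'z' z'z] := CC' (eq_class E z); first by exists z.
    by exists z' => //; have : eq_class E z y by []; rewrite -z'z.
  move=> <-{y}; have [|z' C'z' z'z] := CC' z.
    by exists z => //; exact: Equivalence_Reflexive.
  by exists z' => //; exact: classE.
by split=> /seteqP[/sub BB' /sub B'B]; apply/seteqP.
Qed.

Lemma fs_jumpE E e e' : Equivalence E -> fs_jump E e e' <->
  saturation E [set y | exists n, phi e n y] =
  saturation E [set y | exists n, phi e' n y].
Proof. exact: eq_class_image. Qed.

Lemma ceer_sigma1 E x y : ceer E -> computable x -> computable y ->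
  sigma1 (fun z => E (x z) (y z)).
Proof.
move=> [_ [e EW]] xC yC.
have := @sigma1_W (fun _ => e) (fun z => pair_nat (x z) (y z)).
rewrite -EW /= => S; apply: sigma1_ext (S _ _); [|computability..].
by move=> z; rewrite -/(pr1 _) -/(pr2 _) !prE.
Qed.

Lemma fs_jump_reducible E : ceer E -> reducible (fs_jump E) eq_ce.
Proof.
move=> EC.
have [|g gC gE] := @sigma1_smn (fun z => exists t, (exists n, phi (pr1 z) n t) /\
    E t (pr2 z)).
  apply: sigma1_exists; apply: sigma1_and.
    by apply: sigma1_exists; apply: sigma1_phi; computability.
  by apply: (ceer_sigma1 EC); computability.
have EE := EC.1; exists g; split=> // e e'; rewrite fs_jumpE /eq_ce.
have WE d : W (g d) = saturation E [set y | exists n, phi d n y].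
  apply/seteqP; split=> y.
    by move=> [v /gE[_]]; rewrite !prE => -[z []]; exists z.
  by move=> [z dz zy]; exists y; apply/gE; rewrite !prE; split=> //; exists z.
by rewrite !WE.
Qed.

(** * The relation [collapse A]: infinitely many classes, darkness and highness *)

Lemma collapse_equivalence A : Equivalence (collapse A).
Proof.
split=> [x|x y [->|[]]|x y z [->//|[Ax Ay]] [<-|[_ Az]]].
- by left.
- by left.
- by right.
- by right.
- by right.
Qed.

Lemma collapse_ceer A : ce A -> ceer (collapse A).
Proof.
move=> [a ->]; split; first exact: collapse_equivalence.
apply: sigma1_ce.
rewrite -[sigma1 _]/(sigma1 (fun z => collapse (W a) (pr1 z) (pr2 z))).
apply: sigma1_or.
  by apply: recursive_sigma1; apply: recursive_eq; computability.
by apply: sigma1_and; apply: sigma1_W; computability.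
Qed.

(** Points outside [A] have singleton classes, so distinct ones give distinct classes. *)
Lemma collapse_infinite A : infinite_set (~` A) ->
  infinite_set (range (eq_class (collapse A))).
Proof.
move=> infA fin; apply: infA.
have inj : {in ~` A &, injective (eq_class (collapse A))}.
  move=> x y /set_mem Ax /set_mem Ay E.
  have : eq_class (collapse A) x y by rewrite E; left.
  by case=> // -[/Ax].
have := sub_finite_set
  (image_subset (eq_class (collapse A)) (@subsetT _ (~` A))) fin.
by rewrite (eq_finite_set (inj_card_eq inj)).
Qed.

Lemma simple_collapse_not_light A : simple_set A ->
  ~ reducible eq (collapse A).
Proof.
move=> [_ _ simA] [f [fC fE]].
have fI : injective f by move=> x y xy; apply/fE; left.
(* Two arguments with values in [A] have equivalent values, hence are equal; [n0] is the only
   possible exception, or 0 if there is none. *)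
have [n0 n0P] : exists n0, forall n, n <> n0 -> ~ A (f n).
  have [[n An]|nA] := pselect (exists n, A (f n)); last first.
    by exists 0 => n _ An; apply: nA; exists n.
  by exists n => m ne Am; apply: ne; apply/fE; right.
apply: (simA (f @` [set~ n0])).
- apply: sigma1_ce.
  have : sigma1 (fun x => exists n, n <> n0 /\ f n = x).
    apply: sigma1_exists; apply: recursive_sigma1; apply: recursive_and.
      by apply: recursive_not; apply: recursive_eq; computability.
    by apply: recursive_eq; computability.
  by apply: sigma1_ext => x; split=> -[n]; [case|]; exists n.
- move=> fin; apply: infinite_nat.
  have -> : [set: nat] = [set n0] `|` [set~ n0] by rewrite setUv.
  rewrite finite_setU; split; first exact: finite_set1.
  by rewrite -(eq_finite_set (inj_card_eq (f := f) _)) // => x y _ _; exact: fI.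
- by move=> _ [n /= ne <-]; exact: n0P.
Qed.

Lemma eq_ce_reducible A f : computable f ->
  trivIset setT (fun n => W (f n)) -> (forall n, ~ W (f n) `<=` A) ->
  reducible eq_ce (fs_jump (collapse A)).
Proof.
move=> fC disj nsub.
have [|g gC gE] := @sigma1_smn (fun z =>
    exists n, W (pr1 z) n /\ W (f n) (pr2 z)).
  by apply: sigma1_exists; apply: sigma1_and; apply: sigma1_W; computability.
have rangeE e : [set y | exists n, phi (g e) n y] = \bigcup_(n in W e) W (f n).
  apply/seteqP; split=> y.
    by move=> [x /gE[->]]; rewrite !prE => -[n []]; exists n.
  by move=> [n en fny]; exists y; apply/gE; rewrite !prE; split=> //; exists n.
exists g; split=> // e e'.
rewrite (fs_jumpE _ _ (collapse_equivalence A)) !rangeE /eq_ce.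
split=> [->//|].
have sub d d' : saturation (collapse A) (\bigcup_(n in W d) W (f n)) `<=`
    saturation (collapse A) (\bigcup_(n in W d') W (f n)) -> W d `<=` W d'.
  move=> dd' n dn.
  (* The point [x] outside [A] is equivalent only to itself, so it lies in some [W (f m)] with [m]
     in [W d']; disjointness then gives [m = n]. *)
  have [x [fnx nAx]] : exists x, W (f n) x /\ ~ A x.
    apply: contrapT => nE; apply: (nsub n) => x fnx; apply: contrapT => nAx.
    by apply: nE; exists x.
  have [|z [m d'm fmz] zx] := dd' x; first by exists x; [exists n|left].
  case: zx => [zx|[_ /nAx]//]; rewrite zx in fmz.
  by have <- : m = n by apply: disj => //; exists x.
by move=> /seteqP[/sub ee' /sub e'e]; apply/seteqP.
Qed.

Theorem theorem4p7 (A : set nat) :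
  simple_set A -> ~ hyperhypersimple A ->
  dark (collapse A) /\ high_for_fs_jump (collapse A).
Proof.
move=> simA nhhA; have [ceA infA _] := simA.
have EC := collapse_ceer ceA.
have [f [fC disj nsub]] : exists f, [/\ computable f,
    trivIset setT (fun n => W (f n)) & forall n, ~ W (f n) `<=` A].
  apply: contrapT => nE; apply: nhhA; split=> // f fC _ disj.
  apply: contrapT => nsub; apply: nE; exists f; split=> // n fnA.
  by apply: nsub; exists n.
split; split=> //.
- exact: collapse_infinite.
- exact: simple_collapse_not_light.
- split; first exact: fs_jump_reducible.
  exact: eq_ce_reducible fC disj nsub.
Qed.
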